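(* Let $n\ge 2$, $t\ge 3$, let $\Sigma^*=PG(V,\mathbb{F}_{q^t})=PG(tn-1,q^t)$, let $\Psi$ be a semilinear collineation of $\Sigma^*$ of order $t$ whose set of fixed points $\Sigma$ is a subgeometry isomorphic to $PG(tn-1,q)$, let $\mathcal D$ be a Desarguesian $(t-1)$-spread of $\Sigma$ and let $\Theta$ be a director space of $\mathcal D$. Let $i_1,i_2\in\{0,1,\dots,t-1\}$ with $\gcd(i_2-i_1,t)=1$, and put $\Gamma=\langle\Theta^{\Psi^i}: i\in\{0,\dots,t-1\}\setminus\{i_1,i_2\}\rangle_{q^t}$ and $\Lambda=\langle\Theta^{\Psi^{i_1}},\Theta^{\Psi^{i_2}}\rangle_{q^t}$. Then $\Gamma$ is an $(n(t-2)-1)$-dimensional subspace disjoint from $\Sigma$ and from $\Lambda$, $\Lambda$ has dimension $2n-1$, and the projection $p_{\Gamma,\Lambda}(\Sigma)$ is a scattered $\mathbb{F}_q$-linear set of $\Lambda$ of rank $tn$ of type $L_{\rho,f}$; in particular it is of pseudoregulus type with transversal spaces $\Theta^{\Psi^{i_1}}$ and $\Theta^{\Psi^{i_2}}$.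
   Context: Director spaces / Desarguesian spreads: if $\Theta$ is an $(n-1)$-dimensional subspace of $\Sigma^*$ such that $\Theta,\Theta^\Psi,\dots,\Theta^{\Psi^{t-1}}$ span $\Sigma^*$, then $\mathcal D(\Theta)=\{\langle P,P^\Psi,\dots,P^{\Psi^{t-1}}\rangle_{q^t}\cap\Sigma: P\in\Theta\}$ is a $(t-1)$-spread of $\Sigma$ (a partition of the points of $\Sigma$ into $(t-1)$-dimensional subspaces), called Desarguesian; a Desarguesian spread $\mathcal D$ of $\Sigma$ is one of the form $\mathcal D(\Theta)$, and the subspaces $\Theta^{\Psi^i}$, $i=0,\dots,t-1$, are its director spaces. Projection: if $\Gamma$ is a subspace of $\Sigma^*$ disjoint from $\Sigma$ and $\Lambda$ a subspace disjoint from $\Gamma$ with $\dim\Gamma+\dim\Lambda=\dim\Sigma^*-1$, then $p_{\Gamma,\Lambda}(\Sigma)=\{\langle\Gamma,P\rangle_{q^t}\cap\Lambda: P\in\Sigma\}$. Type $L_{\rho,f}$: writing $\Lambda=PG(V',\mathbb{F}_{q^t})$, a linear set of type $L_{\rho,f}$ is $\{\langle\mathbf u+\rho f(\mathbf u)\rangle_{q^t}:\mathbf u\in U_1\setminus\{\mathbf 0\}\}$ for some decomposition $V'=U_1\oplus U_2$ with $\dim U_1=\dim U_2=n$, some invertible semilinear $f:U_1\to U_2$ whose companion automorphism $\sigma$ satisfies $\mathrm{Fix}(\sigma)=\mathbb{F}_q$, and some $\rho\in\mathbb{F}_{q^t}^*$; its transversal spaces are $PG(U_1,\mathbb{F}_{q^t})$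 and $PG(U_2,\mathbb{F}_{q^t})$. A linear set $L_U$ ($U$ an $\mathbb F_q$-subspace) is scattered if $\dim_{\mathbb F_q}(U\cap\langle\mathbf u\rangle_{q^t})=1$ for all nonzero $\mathbf u\in U$. Pseudoregulus type: for $t,n\ge2$, a scattered $\mathbb{F}_q$-linear set $L$ of $PG(2n-1,q^t)$ of rank $tn$ such that (i) there are $(q^{nt}-1)/(q^t-1)$ pairwise disjoint lines each meeting $L$ in a linear set of rank $t$, and (ii) there are exactly two $(n-1)$-dimensional subspaces (transversal spaces) disjoint from $L$ meeting all these lines. *)

(* Defs.v *)
(* Projective geometry over a finite field F = F_{q^t}:
   Sigma* = PG(V, F) with V = 'rV[F]_N (N = t*n); subspaces of Sigma* are
   row spaces of matrices (mxalgebra, scope %MS); projective dimension =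
   \rank - 1; a point <v> is represented by the canonical matrix <<v>>%MS. *)
From HB Require Import structures.
From mathcomp Require Import all_boot all_order all_algebra all_field.
Set Implicit Arguments. Unset Strict Implicit. Unset Printing Implicit Defensive.
Import GRing.Theory.
Local Open Scope ring_scope.

Section Defs.
Variable F : finFieldType.

Definition in_Fq (q : nat) (x : F) : bool := x ^+ q == x.

Definition mxmap_rows (m N : nat) (g : 'rV[F]_N -> 'rV[F]_N) (A : 'M[F]_(m, N))
  : 'M[F]_(m, N) := \matrix_(i, j) g (row i A) 0 j.

Definition psi_img (N : nat) (psi : 'rV[F]_N -> 'rV[F]_N) (i : nat) (A : 'M[F]_N)
  : 'M[F]_N := mxmap_rows (iter i psi) A.

Definition semilinear_map (N : nat) (sigma : F -> F) (g : 'rV[F]_N -> 'rV[F]_N) : Prop :=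
  (forall u v, g (u + v) = g u + g v) /\ (forall a v, g (a *: v) = sigma a *: g v).

(* g induces the identity collineation *)
Definition is_scalar_map (N : nat) (g : 'rV[F]_N -> 'rV[F]_N) : Prop :=
  exists c : F, forall v, g v = c *: v.

Definition collineation_order (N : nat) (psi : 'rV[F]_N -> 'rV[F]_N) (t : nat) : Prop :=
  (0 < t)%N /\ is_scalar_map (iter t psi) /\
  (forall k, (0 < k < t)%N -> ~ is_scalar_map (iter k psi)).

Definition fixed_pt (N : nat) (psi : 'rV[F]_N -> 'rV[F]_N) (v : 'rV[F]_N) : bool :=
  (v != 0) && (psi v <= v)%MS.

(* the set of fixed points is a subgeometry isomorphic to PG(N-1, q):
   in a suitable frame B it is exactly the set of points with F_q-coordinates *)
Definition fixed_subgeometry (q N : nat) (psi : 'rV[F]_N -> 'rV[F]_N) : Prop :=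
  exists2 B : 'M[F]_N, B \in unitmx &
    forall v : 'rV[F]_N, v != 0 ->
      (fixed_pt psi v <->
       exists u : 'rV[F]_N, [/\ u != 0, (forall j, in_Fq q (u 0 j)) & (v == u *m B)%MS]).

Definition spans_all (t N : nat) (psi : 'rV[F]_N -> 'rV[F]_N) (Th : 'M[F]_N) : bool :=
  ((\sum_(i < t) psi_img psi i Th)%MS == 1%:M)%MS.

Definition director_space (t n : nat) (psi : 'rV[F]_(t * n) -> 'rV[F]_(t * n))
  (Th : 'M[F]_(t * n)) : Prop :=
  exists Th0 : 'M[F]_(t * n), exists j : 'I_t,
    [/\ \rank Th0 = n, spans_all t psi Th0 & (Th == psi_img psi j Th0)%MS].

Definition Fq_subspace (q N : nat) (U : {set 'rV[F]_N}) : Prop :=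
  [/\ 0 \in U, (forall u v, u \in U -> v \in U -> u + v \in U) &
      (forall a u, in_Fq q a -> u \in U -> a *: u \in U)].

Definition linear_set (N : nat) (U : {set 'rV[F]_N}) : {set 'M[F]_N} :=
  [set <<u>>%MS | u in U :\ 0].

(* dim_{F_q}(U cap <u>) = 1 for all nonzero u in U (|U cap <u>| = q) *)
Definition scattered (q N : nat) (U : {set 'rV[F]_N}) : Prop :=
  forall u, u \in U -> u != 0 -> #|[set w in U | (w <= u)%MS]| = q.

Definition type_L_rho_f (q n N : nat) (Lam : 'M[F]_N) (L : {set 'M[F]_N}) : Prop :=
  exists U1 U2 : 'M[F]_N, exists f : 'rV[F]_N -> 'rV[F]_N,
  exists sigma : {rmorphism F -> F}, exists rho : F,
  [/\ [/\ (U1 + U2 == Lam)%MS, (U1 :&: U2 == (0 : 'M[F]_N))%MS, \rank U1 = n & \rank U2 = n],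
      [/\ forall u, (u <= U1)%MS -> (f u <= U2)%MS,
          forall u v, (u <= U1)%MS -> (v <= U1)%MS -> f (u + v) = f u + f v,
          forall a u, (u <= U1)%MS -> f (a *: u) = sigma a *: f u,
          forall u v, (u <= U1)%MS -> (v <= U1)%MS -> f u = f v -> u = v &
          forall w, (w <= U2)%MS -> exists2 u, (u <= U1)%MS & f u = w],
      (forall x, sigma x = x <-> in_Fq q x),
      rho != 0 &
      L = [set <<u + rho *: f u>>%MS | u in [set u : 'rV[F]_N | (u <= U1)%MS & u != 0]]].

Definition pseudoregulus (q t n N : nat) (Lam : 'M[F]_N) (U : {set 'rV[F]_N})
  (T1 T2 : 'M[F]_N) : Prop :=
  [/\ scattered q U, #|U| = (q ^ (t * n))%N &
  exists S : {set 'M[F]_N},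
  [/\ #|S| = ((q ^ (n * t) - 1) %/ (q ^ t - 1))%N,
      (forall l, l \in S ->
         [/\ l = <<l>>%MS, (l <= Lam)%MS, \rank l = 2%N &
             #|[set u in U | (u <= l)%MS]| = (q ^ t)%N]),
      (forall l l', l \in S -> l' \in S -> l != l' -> (l :&: l' == (0 : 'M[F]_N))%MS),
      [/\ ~~ (T1 == T2)%MS, (T1 <= Lam)%MS, (T2 <= Lam)%MS, \rank T1 = n & \rank T2 = n] &
      (forall T : 'M[F]_N, (T <= Lam)%MS -> \rank T = n ->
         ((forall u, u \in U -> u != 0 -> ~~ (u <= T)%MS) /\
          (forall l, l \in S -> ~~ (T :&: l == (0 : 'M[F]_N))%MS)
          <-> (T == T1)%MS \/ (T == T2)%MS))]].

Definition projection (N : nat) (psi : 'rV[F]_N -> 'rV[F]_N) (Gam Lam : 'M[F]_N)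
  : {set 'M[F]_N} :=
  [set <<((Gam + v) :&: Lam)>>%MS | v in [set v : 'rV[F]_N | fixed_pt psi v]].

End Defs.
Arguments director_space {F} t n psi Th.

(* Main.v *)
Require Import Defs.
From HB Require Import structures.
From mathcomp Require Import all_boot all_order all_algebra all_field.
From mathcomp Require Import mxabelem.
Import GRing.Theory.
Local Open Scope ring_scope.
Set Implicit Arguments. Unset Strict Implicit. Unset Printing Implicit Defensive.

(* In the frame of the subgeometry Sigma, Psi is a scalar multiple of the
   coordinatewise action of sigma, Fix(sigma) = F_q, and the points of Sigma are
   those of the vectors w fixed by that action. As V is the direct sum of the
   Theta^(Psi^i), and the action permutes the summands cyclically, a fixed w is
   determined by its component u in the i1-th summand, which is arbitrary: the
   component in the i2-th summand is g u, with g the power of the action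
   carrying i1 to i2. Projecting from Gamma therefore yields the set of all
   u + g u, and the companion automorphism of g has fixed field F_q because
   gcd(i2 - i1, t) = 1.
   The lines of the pseudoregulus are the <u, g u>. A transversal T has as many
   points as there are lines, so each of its points lies on one of them. If T
   meets neither summand, then T = {u + a g u} with a constant a, which
   contradicts the nontriviality of the companion automorphism; if T meets one
   of the summands, it equals that summand. *)

(** * The solutions of x^q = x in F *)

Lemma dvdp_XnsubX_exp (R : fieldType) (q k : nat) :
  ('X^q - 'X : {poly R}) %| 'X^(q ^ k) - 'X.
Proof.
elim: k => [|k IHk]; first by rewrite expn0 expr1 subrr dvdp0.
(* The first bracket is a difference of q-th powers, hence a multiple of the difference of the
   bases, to which the induction hypothesis applies. *)
have -> : 'X^(q ^ k.+1) - 'X = (('X^(q ^ k)) ^+ q - 'X^q) + ('X^q - 'X) :> {poly R}.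
  by rewrite addrA subrK -exprM expnSr.
by rewrite dvdp_add // subrXX dvdp_mulr.
Qed.

(** X^q - X divides X^|F| - X, the product of all X - a with a in F. So it splits over F into
    distinct linear factors, and their number is its degree q. *)
Lemma card_in_Fq (F : finFieldType) (q t : nat) : #|F| = (q ^ t)%N ->
  #|[set x : F | in_Fq q x]| = q.
Proof.
move=> cF; have q1 : (1 < q)%N.
  have := finRing_gt1 F; rewrite cF; case: q {cF} => [|[|q]] //.
    by case: t => [|t]; rewrite ?expn0 ?exp0n.
  by rewrite exp1n.
have := dvdp_XnsubX_exp F q t; rewrite -cF finField_genPoly.
case/dvdp_prod_XsubC => m /[dup] /eqp_size sz /eqp_root rt.
set s := mask m _ in sz rt.
have Us : uniq s by rewrite mask_uniq // /index_enum -enumT enum_uniq.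
have sq : q = size s.
  apply: succn_inj; rewrite -(size_prod_XsubC s id) -sz size_polyDl ?size_polyXn //.
  by rewrite size_polyN size_polyX.
rewrite [RHS]sq -(card_uniqP Us) cardsE; apply: eq_card => x.
by rewrite -root_prod_XsubC -rt rootE !hornerE subr_eq0.
Qed.

Lemma sub_capmx0 (F : fieldType) (m N : nat) (w : 'M[F]_(m, N)) (A B : 'M[F]_N) :
  (A :&: B)%MS = 0 -> (w <= A)%MS -> (w <= B)%MS -> w = 0.
Proof.
move=> AB wA wB; apply: submx0null (_ : (w <= (0 : 'M_N))%MS).
by rewrite -AB sub_capmx wA.
Qed.

(** * Points of a projective space and their number *)

Section Points.
Variables (F : finFieldType) (N : nat).

Definition points (m : nat) (A : 'M[F]_(m, N)) : {set 'M[F]_N} :=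
  [set <<u>>%MS | u in rowg A :\ 0].

Lemma eqmx_rV (u v : 'rV[F]_N) : u != 0 -> (u <= v)%MS -> (u :=: v)%MS.
Proof.
move=> u0 uv; have v0 : v != 0.
  by apply: contraNneq u0 => v0; rewrite v0 in uv; rewrite (submx0null uv).
by apply/eqmxP; rewrite -(mxrank_leqif_eq uv).2 !rank_rV u0 v0.
Qed.

Lemma card_scalar_multiples (u : 'rV[F]_N) : u != 0 ->
  #|[set w : 'rV[F]_N | (w <= u)%MS]| = #|F|.
Proof. by move=> u0; rewrite card_rowg rank_rV u0. Qed.

(** Each fibre of u |-> <<u>> on the nonzero vectors of A consists of the |F| - 1 nonzero multiples
    of one vector, so the division is exact. *)
Lemma card_points m (A : 'M[F]_(m, N)) :
  #|points A| = ((#|F| ^ \rank A - 1) %/ (#|F| - 1))%N.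
Proof.
have F1 := finRing_gt1 F.
have -> : (#|F| ^ \rank A - 1 = #|points A| * (#|F| - 1))%N.
  rewrite -card_rowg (cardsD1 0 (rowg A)) mem_rowg sub0mx addKn.
  rewrite -[in LHS]sum1_card (partition_big_imset (fun u : 'rV[F]_N => <<u>>%MS)) /=.
  rewrite -sum_nat_const; apply: eq_bigr => j /imsetP[u].
  rewrite !inE => /andP[u0 uA] ->.
  rewrite sum1_card -(card_scalar_multiples u0) [in RHS](cardsD1 0) inE sub0mx addKn.
  apply: eq_card => w; rewrite !inE unfold_in /= !inE.
  apply/andP/andP => [[/andP[w0 wA] /eqP/genmxP/andP[]]|[w0 wu]]; first by [].
  rewrite w0 (submx_trans wu uA); split=> //; apply/eqP/eq_genmx.
  exact: eqmx_rV.
by rewrite mulnK // subn_gt0.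
Qed.

End Points.

Lemma leq_card_imset_factor (T T1 T2 : finType) (h : T -> T1) (k : T -> T2) (D : {set T}) :
  {in D &, forall u v, k u = k v -> h u = h v} -> (#|h @: D| <= #|k @: D|)%N.
Proof.
move=> hk; have [->|[u0 u0D]] := set_0Vmem D; first by rewrite !imset0 !cards0.
(* [r y] is a chosen preimage of y under k in D; the default u0 only serves values y outside k @:
   D. *)
pose r y := odflt u0 [pick u in D | k u == y].
apply: leq_trans (leq_imset_card (h \o r) _); apply/subset_leq_card/subsetP.
move=> _ /imsetP[u uD ->]; apply/imsetP; exists (k u); first exact: imset_f.
rewrite /= /r; case: pickP => [v /andP[vD /eqP kv]|/(_ u)]; first exact: hk.
by rewrite uD eqxx.
Qed.

(** * The graph of a semilinear bijection between two disjoint subspaces *)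

Section SemilinearGraph.
Variables (F : finFieldType) (q t n N : nat) (E1 E2 : 'M[F]_N).
Variables (g : 'rV[F]_N -> 'rV[F]_N) (tau : {rmorphism F -> F}).
Hypotheses (cF : #|F| = (q ^ t)%N) (t_gt1 : (1 < t)%N) (n_gt1 : (1 < n)%N).
Hypothesis tau_fix : forall x, tau x = x <-> in_Fq q x.
Hypotheses (capE : (E1 :&: E2)%MS = 0) (rE1 : \rank E1 = n) (rE2 : \rank E2 = n).
Hypotheses (g_semi : semilinear_map tau g) (g_inj : injective g).
Hypothesis gE : forall u, (g u <= E2)%MS = (u <= E1)%MS.

Let gD u v : g (u + v) = g u + g v. Proof. by case: g_semi. Qed.
Let gZ a u : g (a *: u) = tau a *: g u. Proof. by case: g_semi. Qed.
Let g0 : g 0 = 0. Proof. by move: (gZ 0 0); rewrite rmorph0 !scale0r. Qed.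
Let g_eq0 u : (g u == 0) = (u == 0). Proof. by rewrite -{1}g0 (inj_eq g_inj). Qed.

Let tau_bij : bijective tau.
Proof. exact: injF_bij (fmorph_inj tau). Qed.

Let g_sub u v : (g u <= g v)%MS = (u <= v)%MS.
Proof.
have [tauV _ tauK] := tau_bij.
apply/sub_rVP/sub_rVP => [[a]|[a ->]]; last by exists (tau a); rewrite gZ.
by rewrite -[a]tauK -gZ => /g_inj ->; exists (tauV a).
Qed.

(** Injectivity on a finite space makes g surjective, and [gE], being an equivalence, puts the
    preimage in E1. *)
Let gV w : (w <= E2)%MS -> exists2 u, (u <= E1)%MS & w = g u.
Proof.
have [h _ hK] := injF_bij g_inj.
by move=> wE; exists (h w); rewrite ?hK // -gE hK.
Qed.

Let E_disj (u : 'rV[F]_N) : (u <= E1)%MS -> (u <= E2)%MS -> u = 0.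
Proof. exact: sub_capmx0. Qed.

Let E_uniq (x y x' y' : 'rV[F]_N) : (x <= E1)%MS -> (x' <= E1)%MS ->
  (y <= E2)%MS -> (y' <= E2)%MS -> x + y = x' + y' -> x = x' /\ y = y'.
Proof.
move=> x1 x1' y2 y2' e; have e' : x - x' = y' - y.
  by apply/eqP; rewrite subr_eq addrAC eq_sym subr_eq e addrC.
have z : x - x' = 0.
  by apply: E_disj; [|rewrite e']; rewrite addmx_sub ?eqmx_opp.
split; first by apply/eqP; rewrite -subr_eq0 z.
by apply/eqP; rewrite eq_sym -subr_eq0 -e' z.
Qed.

Definition graph_set : {set 'rV[F]_N} := [set u + g u | u in rowg E1].
(** The inner + is the sum of subspaces: this is the line joining the points <u> and <g u>, not the
    point of the vector u + g u. *)
Definition graph_line (u : 'rV[F]_N) : 'M[F]_N := <<(u + g u)%MS>>%MS.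
Definition graph_lines : {set 'M[F]_N} := [set graph_line u | u in rowg E1 :\ 0].

Let card_F_gt1 : (1 < #|F|)%N. Proof. exact: finRing_gt1. Qed.

Let graph_inj : {in rowg E1 &, injective (fun u => u + g u)}.
Proof.
move=> u v; rewrite !inE => u1 v1 /E_uniq[]; rewrite ?gE //.
Qed.

Lemma graph_set_Fq_subspace : Fq_subspace q graph_set.
Proof.
split; first by apply/imsetP; exists 0; rewrite ?g0 ?addr0 // inE sub0mx.
  move=> _ _ /imsetP[u u1 ->] /imsetP[v v1 ->]; rewrite !inE in u1 v1.
  by apply/imsetP; exists (u + v); rewrite ?inE ?addmx_sub // gD addrACA.
move=> a _ /tau_fix ta /imsetP[u u1 ->]; rewrite !inE in u1.
by apply/imsetP; exists (a *: u); rewrite ?inE ?scalemx_sub // gZ ta scalerDr.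
Qed.

Lemma graph_set_sub u : u \in graph_set -> (u <= E1 + E2)%MS.
Proof.
by case/imsetP=> v; rewrite inE => v1 ->; rewrite addmx_sub_adds ?gE.
Qed.

Lemma card_graph_set : #|graph_set| = (q ^ (t * n))%N.
Proof. by rewrite card_in_imset // card_rowg rE1 cF expnM. Qed.

Let graph_line_sub (x y u : 'rV[F]_N) : (x <= E1)%MS -> (y <= E2)%MS -> (u <= E1)%MS ->
  ((x + y)%R <= graph_line u)%MS = (x <= u)%MS && (y <= g u)%MS.
Proof.
move=> x1 y2 u1; rewrite /graph_line genmxE.
apply/idP/andP => [/sub_addsmxP[[a b] /= e]|[xu yu]]; last exact: addmx_sub_adds.
have au : (a *m u <= u)%MS by exact: submxMl.
have bu : (b *m g u <= g u)%MS by exact: submxMl.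
have [] := E_uniq x1 (submx_trans au u1) y2 _ e; last by move=> -> ->.
by rewrite (submx_trans bu) ?gE.
Qed.

(** If a(u + g u) = v + g v, comparing components gives v = a u and a g u = tau(a) g u, so a is
    fixed by tau; there are q such a. *)
Lemma graph_set_scattered : scattered q graph_set.
Proof.
move=> _ /imsetP[u u1 ->] uN0; rewrite inE in u1.
have sI : injective (fun a : F => a *: (u + g u)).
  move=> a b /eqP; rewrite -subr_eq0 -scalerBl scaler_eq0 (negPf uN0) orbF subr_eq0.
  by move/eqP.
have gu0 : g u != 0 by apply: contraNneq uN0 => /eqP; rewrite g_eq0 => /eqP->; rewrite g0 addr0.
rewrite -[RHS](card_in_Fq cF) -(card_imset _ sI); apply: eq_card => w; rewrite !inE.
apply/andP/imsetP => [[/imsetP[v]]|[a]]; rewrite inE.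
  move=> v1 -> /sub_rVP[a e]; exists a => //; rewrite inE; apply/tau_fix.
  have [] := E_uniq v1 (_ : a *: u <= E1)%MS _ (_ : a *: g u <= E2)%MS (etrans e (scalerDr _ _ _)).
  - exact: scalemx_sub.
  - by rewrite gE.
  - by rewrite scalemx_sub ?gE.
  move=> ->; rewrite gZ => /eqP; rewrite -subr_eq0 -scalerBl scaler_eq0 (negPf gu0) orbF subr_eq0.
  by move/eqP.
move=> /tau_fix ta ->; rewrite scalemx_sub //; split=> //.
by apply/imsetP; exists (a *: u); rewrite ?inE ?scalemx_sub // gZ ta scalerDr.
Qed.

Lemma graph_set_type_L_rho_f : type_L_rho_f q n (E1 + E2)%MS (linear_set graph_set).
Proof.
(* The graph is already in normal form, with rho = 1. *)
exists E1, E2, g, tau, 1; split=> //.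
- by rewrite capE; split=> //; apply/andP.
- split=> [u|u v _ _|a u _|u v _ _|w /gV[u u1 ->]] //; first by rewrite gE.
  + exact: g_inj.
  + by exists u.
- exact: oner_neq0.
apply/setP=> P; apply/imsetP/imsetP => [[w /setD1P[w0 /imsetP[u u1 wE]] ->]|[u]].
  rewrite {w}wE in w0 *.
  exists u; last by rewrite scale1r.
  rewrite !inE in u1 *; rewrite u1; apply: contraNneq w0 => u0.
  by rewrite u0 g0 addr0.
rewrite inE => /andP[u1 u0] ->; exists (u + g u); last by rewrite scale1r.
rewrite !inE; apply/andP; split; last by apply/imsetP; exists u; rewrite ?inE.
apply: contraNneq u0 => e.
by have [-> _] : u = 0 /\ g u = 0 by apply: E_uniq; rewrite ?gE ?sub0mx // e addr0.
Qed.

(** The line determines <u>, as its intersection with E1. *)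
Let graph_line_eq (u v : 'rV[F]_N) : (u <= E1)%MS -> (v <= E1)%MS -> u != 0 ->
  (graph_line u == graph_line v) = (<<u>>%MS == <<v>>%MS).
Proof.
move=> u1 v1 u0; apply/eqP/eqP=> [e|/genmxP/andP[uv vu]].
  have : ((u + 0)%R <= graph_line v)%MS by rewrite -e graph_line_sub ?sub0mx ?submx_refl.
  rewrite graph_line_sub ?sub0mx // => /andP[uv _].
  by apply/eq_genmx/eqmx_rV.
by apply/eq_genmx/eqmxP; rewrite !addsmxS ?g_sub.
Qed.

(** On nonzero vectors of E1, u |-> <u> and u |-> [graph_line u] have the same fibres, so each image
    is no larger than the other. *)
Let card_graph_lines : #|graph_lines| = #|points E1|.
Proof.
apply/eqP; rewrite eqn_leq; apply/andP; split; apply: leq_card_imset_factor.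
  by move=> u v; rewrite !inE => /andP[u0 u1] /andP[_ v1] /eqP; rewrite -graph_line_eq // => /eqP.
by move=> u v; rewrite !inE => /andP[u0 u1] /andP[_ v1] /eqP; rewrite graph_line_eq // => /eqP.
Qed.

Let graph_lineP (u w : 'rV[F]_N) : (u <= E1)%MS -> (w <= graph_line u)%MS ->
  exists x y : 'rV[F]_N, [/\ (x <= u)%MS, (y <= g u)%MS & w = x + y].
Proof.
move=> u1; rewrite /graph_line genmxE => /sub_addsmxP[[a b] /= ->].
by exists (a *m u), (b *m g u); rewrite !submxMl.
Qed.

Let graph_lines_disjoint l l' : l \in graph_lines -> l' \in graph_lines ->
  l != l' -> (l :&: l')%MS = 0.
Proof.
move=> /imsetP[u + ->] /imsetP[v + ->]; rewrite !inE => /andP[u0 u1] /andP[v0 v1].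
rewrite graph_line_eq //; apply: contraNeq; rewrite -nz_row_eq0.
set w := nz_row _ => w0.
have [wu wv] : (w <= graph_line u)%MS /\ (w <= graph_line v)%MS.
  by apply/andP; rewrite -sub_capmx nz_row_sub.
have [x [y [xu yu wE]]] := graph_lineP u1 wu.
have x1 : (x <= E1)%MS by exact: submx_trans u1.
have y2 : (y <= E2)%MS by apply: submx_trans yu _; rewrite gE.
move: wv; rewrite wE graph_line_sub // => /andP[xv yv].
(* The common vector x + y has a nonzero component: x gives <u> = <x> inside <v>, or y gives <g u> =
   <y> inside <g v>. *)
have uv : (u <= v)%MS.
  have [x0|x0] := eqVneq x 0; last by rewrite -(eqmx_rV x0 xu).
  have y0 : y != 0 by apply: contraNneq w0 => y0; rewrite wE x0 y0 addr0.
  by rewrite -g_sub -(eqmx_rV y0 yu).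
exact/eqP/eq_genmx/eqmx_rV.
Qed.

Let rank_graph_line (u : 'rV[F]_N) : (u <= E1)%MS -> u != 0 -> \rank (graph_line u) = 2%N.
Proof.
move=> u1 u0; rewrite /graph_line genmxE; apply/eqP.
have := mxrank_sum_cap u (g u); rewrite !rank_rV g_eq0 u0.
have -> : (u :&: g u)%MS = 0.
  apply/eqP; rewrite -submx0 -capE; apply: capmxS => //.
  by rewrite gE.
by rewrite mxrank0 addn0 => ->.
Qed.

Let card_graph_set_line (u : 'rV[F]_N) : (u <= E1)%MS -> u != 0 ->
  #|[set w in graph_set | (w <= graph_line u)%MS]| = (q ^ t)%N.
Proof.
move=> u1 u0; rewrite -cF -(card_scalar_multiples u0).
have -> : [set w in graph_set | (w <= graph_line u)%MS] =
          [set v + g v | v in [set v | (v <= u)%MS]].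
  apply/setP=> w; rewrite inE; apply/andP/imsetP => [[/imsetP[v]]|[v]]; rewrite inE.
    move=> v1 ->; rewrite graph_line_sub ?gE // => /andP[vu _].
    by exists v; rewrite ?inE.
  move=> vu ->; have v1 := submx_trans vu u1; split.
    by apply/imsetP; exists v; rewrite ?inE.
  by rewrite graph_line_sub ?gE // vu g_sub.
rewrite card_in_imset // => v w; rewrite !inE => vu wu.
by apply: graph_inj; rewrite inE; apply: submx_trans u1.
Qed.

(** Otherwise F would have only q elements, against |F| = q^t with t > 1. *)
Lemma exists_tau_moves : exists a, tau a != a.
Proof.
apply/existsP; apply: contraT; rewrite negb_exists => /forallP fix_all.
have: #|F| = q.
  rewrite -[RHS](card_in_Fq cF) -cardsT; apply: eq_card => x; rewrite !inE.
  by apply/esym/tau_fix/eqP; move: (fix_all x); rewrite negbK.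
have q1 : (1 < q)%N.
  move: card_F_gt1; rewrite cF; case: (q) => [|[|k]] //; last by rewrite exp1n.
  by have := t_gt1; case: (t) => // k _; rewrite exp0n.
move=> /eqP; rewrite cF -{2}(expn1 q) eqn_exp2l // => /eqP t1.
by have := t_gt1; rewrite t1.
Qed.

(** * Uniqueness of the two transversal spaces *)

Section Transversal.
Variable T : 'M[F]_N.
Hypothesis rT : \rank T = n.
Hypothesis T_meets : forall u : 'rV[F]_N, (u <= E1)%MS -> u != 0 -> (T :&: graph_line u)%MS != 0.

(* T has as many points as there are lines, and the lines are pairwise disjoint. *)
Lemma transversal_point_on_line (x y : 'rV[F]_N) : (x <= E1)%MS -> (y <= E2)%MS ->
  ((x + y)%R <= T)%MS ->
  exists u : 'rV[F]_N, [/\ (u <= E1)%MS, (x <= u)%MS & (y <= g u)%MS].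
Proof.
move=> x1 y2 xyT; have [xy0|xy0] := eqVneq (x + y) 0.
  have [-> ->] : x = 0 /\ y = 0 by apply: E_uniq; rewrite ?sub0mx // addr0.
  by exists 0; rewrite !sub0mx.
pose pt (l : 'M[F]_N) := (<<nz_row (T :&: l)%MS>>)%MS.
have T_meetsl l : l \in graph_lines -> nz_row (T :&: l)%MS != 0.
  by case/imsetP=> u; rewrite !inE => /andP[u0 u1] ->; rewrite nz_row_eq0 T_meets.
have pt_inj : {in graph_lines &, injective pt}.
  move=> l l' lL lL' /genmxP/andP[ll' _]; apply: contraNeq (T_meetsl l lL) => nll'.
  have := nz_row_sub (T :&: l)%MS; set w := nz_row _ in ll' *.
  rewrite sub_capmx => /andP[_ wl].
  have := nz_row_sub (T :&: l')%MS; rewrite sub_capmx => /andP[_ /(submx_trans ll') wl'].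
  exact/eqP/(sub_capmx0 (graph_lines_disjoint lL lL' nll')).
(* An injection between sets of equal size is onto: every point of T is the chosen point of some
   line. *)
have ptT : pt @: graph_lines = points T.
  apply/eqP; rewrite eqEcard (card_in_imset pt_inj) card_graph_lines !card_points.
  rewrite rE1 rT leqnn andbT.
  apply/subsetP=> _ /imsetP[l lL ->]; apply/imset_f.
  rewrite !inE T_meetsl // (submx_trans (nz_row_sub _)) //; exact: capmxSl.
have : <<x + y>>%MS \in points T by apply/imset_f; rewrite !inE xy0.
rewrite -ptT => /imsetP[l lL /genmxP/andP[xyl _]].
have : ((x + y)%R <= l)%MS.
  by apply: submx_trans xyl _; apply: submx_trans (nz_row_sub _) _; exact: capmxSr.
case/imsetP: lL => u; rewrite !inE => /andP[u0 u1] ->.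
by rewrite graph_line_sub // => /andP[xu yu]; exists u.
Qed.

Lemma transversal_meets (u : 'rV[F]_N) : (u <= E1)%MS -> u != 0 ->
  exists x y : 'rV[F]_N,
    [/\ (x <= u)%MS, (y <= g u)%MS, ((x + y)%R <= T)%MS & (x != 0) || (y != 0)].
Proof.
move=> u1 u0; have := T_meets u1 u0; rewrite -nz_row_eq0; set w := nz_row _ => w0.
have : (w <= T :&: graph_line u)%MS by exact: nz_row_sub.
rewrite sub_capmx => /andP[wT /(graph_lineP u1)[x [y [xu yu wE]]]].
exists x, y; rewrite -wE; split=> //.
by rewrite -negb_and; apply: contraNN w0 => /andP[/eqP x0 /eqP y0]; rewrite wE x0 y0 addr0.
Qed.

Let sub_eq (A : 'M[F]_N) : \rank A = n ->
  (forall v : 'rV_N, (v <= A)%MS -> (v <= T)%MS) -> (T == A)%MS.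
Proof.
move=> rA AT; have {}AT : (A <= T)%MS by apply/rV_subP.
by rewrite andbC -(mxrank_leqif_eq AT).2 rA rT.
Qed.

(** Suppose v in E1 is not in T. T meets the line of v in some x + y with y nonzero. The vector (u +
    x) + y of T lies on the line of some w, and y forces <w> = <v>. Hence u + x, and so u, lies in
    <v>, which puts v in T. *)
Lemma transversal_meeting_E1 (u : 'rV[F]_N) : u != 0 -> (u <= E1)%MS -> (u <= T)%MS -> (T == E1)%MS.
Proof.
move=> u0 u1 uT; apply: sub_eq => // v v1; apply: contraT => vT.
have v0 : v != 0 by apply: contraNneq vT => ->; rewrite sub0mx.
have [x [y [xv yv xyT xy0]]] := transversal_meets v1 v0.
have x1 := submx_trans xv v1.
have y2 : (y <= E2)%MS by apply: submx_trans yv _; rewrite gE.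
have y0 : y != 0.
  apply: contraNneq vT => y0; rewrite y0 eqxx orbF addr0 in xy0 xyT.
  by rewrite -(eqmx_rV xy0 xv).
have [||w [w1 uxw yw]] := @transversal_point_on_line (u + x) y _ y2.
- exact: addmx_sub.
- by rewrite -addrA addmx_sub.
have wv : (w <= v)%MS by rewrite -g_sub -(eqmx_rV y0 yw).
have uv : (u <= v)%MS.
  by rewrite -[u](addrK x) addmx_sub ?eqmx_opp // (submx_trans uxw).
by case/negP: vT; rewrite -(eqmx_rV u0 uv).
Qed.

(** The same argument with the two components exchanged: x now identifies the line through x + (y +
    u). *)
Lemma transversal_meeting_E2 (u : 'rV[F]_N) : u != 0 -> (u <= E2)%MS -> (u <= T)%MS -> (T == E2)%MS.
Proof.
move=> u0 u2 uT; apply: sub_eq => // _ /gV[v v1 ->]; apply: contraT => vT.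
have v0 : v != 0 by apply: contraNneq vT => ->; rewrite g0 sub0mx.
have [x [y [xv yv xyT xy0]]] := transversal_meets v1 v0.
have x1 := submx_trans xv v1.
have y2 : (y <= E2)%MS by apply: submx_trans yv _; rewrite gE.
have x0 : x != 0.
  apply: contraNneq vT => x0; rewrite x0 eqxx add0r in xy0 xyT.
  by rewrite -(eqmx_rV xy0 yv).
have [||w [w1 xw uyw]] := @transversal_point_on_line x (y + u) x1.
- exact: addmx_sub.
- by rewrite addrA addmx_sub.
have wv : (w <= v)%MS by rewrite -(eqmx_rV x0 xw).
have uv : (u <= g v)%MS.
  by rewrite -[u](addKr y) addmx_sub ?eqmx_opp // (submx_trans uyw) // g_sub.
by case/negP: vT; rewrite -(eqmx_rV u0 uv).
Qed.

(** The sum of the two vectors of T lies on a line of the family, which must be that of u + v. So a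
    g u + b g v = c (g u + g v) for some c, and independence of g u and g v gives a = c = b. *)
Lemma transversal_multiplier_const (u v : 'rV[F]_N) (a b : F) :
  (u <= E1)%MS -> (v <= E1)%MS -> u != 0 -> ~~ (v <= u)%MS ->
  ((u + a *: g u)%R <= T)%MS -> ((v + b *: g v)%R <= T)%MS -> a = b.
Proof.
move=> u1 v1 u0 vu uT vT.
have uv0 : u + v != 0.
  apply: contraNneq vu => /eqP; rewrite addr_eq0 => /eqP->.
  by rewrite eqmx_opp submx_refl.
have [|||w [w1 uvw gw]] := @transversal_point_on_line (u + v) (a *: g u + b *: g v).
- exact: addmx_sub.
- by rewrite addmx_sub ?scalemx_sub ?gE.
- by rewrite addrACA addmx_sub.
have /sub_rVP[c] : ((a *: g u + b *: g v)%R <= g (u + v))%MS.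
  by apply: submx_trans gw _; rewrite g_sub (eqmx_rV uv0 uvw).
rewrite gD scalerDr => /eqP; rewrite -subr_eq0 opprD addrACA -!scalerBl => /eqP e.
have bc : b - c = 0.
  apply: contraNeq vu => bc0; rewrite -g_sub -(eqmx_scale _ bc0).
  move/eqP: e; rewrite addrC addr_eq0 => /eqP->.
  by rewrite eqmx_opp scalemx_sub.
move/eqP: e; rewrite bc scale0r addr0 scaler_eq0 g_eq0 (negPf u0) orbF subr_eq0 => /eqP->.
by move/eqP: bc; rewrite subr_eq0 => /eqP.
Qed.

Lemma transversal_eq : (T == E1)%MS \/ (T == E2)%MS.
Proof.
have [|T1] := boolP [exists u : 'rV[F]_N, [&& u != 0, (u <= E1)%MS & (u <= T)%MS]].
  by case/existsP=> u /and3P[u0 u1 uT]; left; exact: transversal_meeting_E1 uT.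
have [|T2] := boolP [exists u : 'rV[F]_N, [&& u != 0, (u <= E2)%MS & (u <= T)%MS]].
  by case/existsP=> u /and3P[u0 u2 uT]; right; exact: transversal_meeting_E2 uT.
exfalso.
have {}T1 (u : 'rV[F]_N) : (u <= E1)%MS -> (u <= T)%MS -> u = 0.
  by move=> u1 uT; apply: contraNeq T1 => u0; apply/existsP; exists u; rewrite u0 u1.
have {}T2 (u : 'rV[F]_N) : (u <= E2)%MS -> (u <= T)%MS -> u = 0.
  by move=> u1 uT; apply: contraNeq T2 => u0; apply/existsP; exists u; rewrite u0 u1.
have mult (u : 'rV[F]_N) : (u <= E1)%MS -> u != 0 -> exists a, ((u + a *: g u)%R <= T)%MS.
  move=> u1 u0; have [x [y [/sub_rVP[a ->] /sub_rVP[b ->] abT ab0]]] := transversal_meets u1 u0.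
  have a0 : a != 0.
    apply: contraTneq ab0 => a0; rewrite a0 scale0r add0r eqxx in abT *.
    by rewrite (T2 _ _ abT) ?eqxx // scalemx_sub ?gE.
  exists (a^-1 * b); rewrite -[u in (u + _)%R](scalerK a0) -scalerA -scalerDr.
  exact: scalemx_sub.
have [a ta] := exists_tau_moves.
have a0 : a != 0 by apply: contraNneq ta => ->; rewrite rmorph0.
pose u := nz_row E1.
have u1 : (u <= E1)%MS by exact: nz_row_sub.
have u0 : u != 0.
  by rewrite nz_row_eq0 -mxrank_eq0 rE1; have := n_gt1; case: (n).
(* As n > 1, E1 contains some v independent of u. Compared with v, both u and a u get the same
   multiplier b. *)
have /row_subPn[i vu] : ~~ (E1 <= u)%MS.
  apply: contraTN (n_gt1) => /mxrankS; rewrite rE1 rank_rV u0 -leqNgt.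
  by [].
set v := row i E1 in vu; have v1 : (v <= E1)%MS by exact: row_sub.
have v0 : v != 0 by apply: contraNneq vu => ->; rewrite sub0mx.
have au0 : a *: u != 0 by rewrite scaler_eq0 negb_or a0.
have au1 : (a *: u <= E1)%MS by exact: scalemx_sub.
have [b bT] := mult u u1 u0; have [c cT] := mult v v1 v0.
have [d dT] := mult _ au1 au0.
have bc : b = c by exact: transversal_multiplier_const bT cT.
have dc : d = c.
  by apply: transversal_multiplier_const dT cT => //; rewrite eqmx_scale.
(* T contains a u + b g(a u) and a (u + b g u); their difference lies in E2, hence vanishes. So b =
   0 and u itself is in T, a contradiction. *)
have : ((b * (tau a - a)) *: g u <= T)%MS.
  have -> : (b * (tau a - a)) *: g u = (a *: u + d *: g (a *: u)) - a *: (u + b *: g u).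
    rewrite gZ dc -bc mulrBr scalerBl scalerDr !scalerA opprD addrACA subrr add0r.
    by rewrite [a * b]mulrC.
  by rewrite addmx_sub // eqmx_opp scalemx_sub.
move/T2 => /(_ _)/eqP; rewrite scaler_eq0 g_eq0 (negPf u0) orbF mulf_eq0 subr_eq0 (negPf ta) orbF.
rewrite scalemx_sub ?gE // => /(_ isT)/eqP b0.
by move: bT; rewrite b0 scale0r addr0 => /(T1 _ u1)/eqP; rewrite (negPf u0).
Qed.

End Transversal.

Lemma graph_set_pseudoregulus : pseudoregulus q t n (E1 + E2)%MS graph_set E1 E2.
Proof.
split; [exact: graph_set_scattered | exact: card_graph_set |].
exists graph_lines; split.
- by rewrite card_graph_lines card_points rE1 cF -expnM mulnC.
- move=> _ /imsetP[u + ->]; rewrite !inE => /andP[u0 u1]; split.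
  + by rewrite /graph_line genmx_id.
  + by rewrite /graph_line genmxE addsmxS ?gE.
  + exact: rank_graph_line.
  + exact: card_graph_set_line.
- move=> l l' lL lL' ll'; rewrite (graph_lines_disjoint lL lL' ll').
  by rewrite submx_refl.
- split; rewrite ?addsmxSl ?addsmxSr //.
  apply/negP=> /andP[/capmx_idPl e _]; move: n_gt1.
  by rewrite -rE1 -e capE mxrank0.
move=> T TE rT; split=> [[_ meets]|].
  apply: transversal_eq => // u u1 u0.
  have := meets (graph_line u); rewrite submx0 sub0mx andbT; apply.
  by apply/imset_f; rewrite !inE u0.
have uN0 (u : 'rV[F]_N) : (u <= E1)%MS -> u + g u != 0 -> u != 0.
  by move=> _; apply: contraNneq => ->; rewrite g0 addr0.
have Tl (l : 'M[F]_N) (w : 'rV[F]_N) : w != 0 -> (w <= T)%MS -> (w <= l)%MS ->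
    ~~ (T :&: l == (0 : 'M[F]_N))%MS.
  move=> w0 wT wl; apply: contraNN w0 => /andP[T0 _].
  by apply/eqP/(sub_capmx0 (submx0null T0)).
(* Conversely, if u + g u lies in E1 or in E2, one of u, g u lies in both summands, so u = 0. Each
   line meets E1 in u and E2 in g u. *)
case=> /eqmxP eT; split.
- move=> _ /imsetP[u + ->] w0; rewrite inE eT => u1; apply/negP=> w1.
  have gu1 : (g u <= E1)%MS.
    by rewrite -[g u](addKr u) addmx_sub ?eqmx_opp.
  by case/eqP: (uN0 u u1 w0); apply/eqP; rewrite -g_eq0 (E_disj gu1) ?gE.
- move=> _ /imsetP[u + ->]; rewrite !inE => /andP[u0 u1].
  by apply: (Tl _ u); rewrite ?eT // /graph_line genmxE addsmxSl.
- move=> _ /imsetP[u + ->] w0; rewrite inE eT => u1; apply/negP=> w2.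
  have u2 : (u <= E2)%MS.
    by rewrite -[u](addrK (g u)) addmx_sub ?eqmx_opp ?gE.
  by case/eqP: (uN0 u u1 w0); apply: E_disj.
- move=> _ /imsetP[u + ->]; rewrite !inE => /andP[u0 u1].
  by apply: (Tl _ (g u)); rewrite ?g_eq0 ?eT ?gE // /graph_line genmxE addsmxSr.
Qed.

End SemilinearGraph.

Lemma mxrank_sums_leq (F : fieldType) (I : finType) (P : pred I) (N : nat) (A : I -> 'M[F]_N) :
  (\rank (\sum_(i | P i) A i)%MS <= \sum_(i | P i) \rank (A i))%N.
Proof.
elim/big_rec2: _ => [|i r B _ IH]; first by rewrite mxrank0.
exact: leq_trans (mxrank_adds_leqif _ _).1 (leq_add (leqnn _) IH).
Qed.

(** * The coordinatewise action of a field automorphism in a frame *)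

Section TwistedAction.
Variables (F : finFieldType) (N : nat) (sigma : {rmorphism F -> F}) (B : 'M[F]_N).
Hypothesis uB : B \in unitmx.

(** Iteration is done on bundled morphisms, so that each power of sigma can serve as a companion
    automorphism. *)
Fixpoint rmorph_iter (i : nat) : {rmorphism F -> F} :=
  if i is j.+1 then [the {rmorphism F -> F} of sigma \o rmorph_iter j]
  else [the {rmorphism F -> F} of idfun].

Lemma rmorph_iterE i x : rmorph_iter i x = iter i sigma x.
Proof. by elim: i => //= i ->. Qed.

(* In the frame B, this is the i-th power of the coordinatewise action of sigma. *)
Definition twist (i : nat) (m : nat) (A : 'M[F]_(m, N)) : 'M[F]_(m, N) :=
  map_mx (rmorph_iter i) (A *m invmx B) *m B.

Lemma twist0 m (A : 'M[F]_(m, N)) : twist 0 A = A.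
Proof. by rewrite /twist map_mx_id // mulmxKV. Qed.

Lemma twist_add i j m (A : 'M[F]_(m, N)) : twist (i + j) A = twist i (twist j A).
Proof.
rewrite /twist mulmxK // -map_mx_comp; congr (_ *m _); apply: eq_map_mx => x /=.
by rewrite !rmorph_iterE iterD.
Qed.

Lemma twistM i m p (u : 'M[F]_(m, p)) (A : 'M[F]_(p, N)) :
  twist i (u *m A) = map_mx (rmorph_iter i) u *m twist i A.
Proof. by rewrite /twist -mulmxA map_mxM mulmxA. Qed.

Lemma twist_sum i m (I : Type) (r : seq I) (P : pred I) (A : I -> 'M[F]_(m, N)) :
  twist i (\sum_(j <- r | P j) A j) = \sum_(j <- r | P j) twist i (A j).
Proof. by rewrite /twist mulmx_suml map_mx_sum mulmx_suml. Qed.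

Lemma twistD i m (A C : 'M[F]_(m, N)) : twist i (A + C) = twist i A + twist i C.
Proof. by rewrite /twist mulmxDl map_mxD mulmxDl. Qed.

Lemma twist_semilinear i : semilinear_map (rmorph_iter i) (@twist i 1).
Proof.
split=> [u v|a v]; first exact: twistD.
by rewrite /twist -scalemxAl map_mxZ -scalemxAl.
Qed.

Lemma twist_mx0 i m : twist i (0 : 'M[F]_(m, N)) = 0.
Proof. by rewrite /twist mul0mx map_mx0 mul0mx. Qed.

Lemma twist_sub i m p (A : 'M[F]_(m, N)) (C : 'M[F]_(p, N)) :
  (twist i A <= twist i C)%MS = (A <= C)%MS.
Proof. by rewrite /twist !submxMfree ?map_submx ?submxMfree ?row_free_unit ?unitmx_inv. Qed.

Lemma rank_twist i m (A : 'M[F]_(m, N)) : \rank (twist i A) = \rank A.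
Proof. by rewrite /twist !mxrankMfree ?mxrank_map ?mxrankMfree ?row_free_unit ?unitmx_inv. Qed.

Lemma twist_inj i m : injective (@twist i m).
Proof.
move=> A C /(can_inj (mulmxK uB)) /(map_mx_inj (f := rmorph_iter i)).
by move/(can_inj (mulmxKV uB)).
Qed.

Lemma twist_fixed i m (A : 'M[F]_(m, N)) : twist 1 A = A -> twist i A = A.
Proof. by move=> fA; elim: i => [|i IH]; rewrite ?twist0 // -addn1 twist_add fA. Qed.

Lemma twist_sums_sub i m (w : 'M[F]_(m, N)) (I : finType) (P : pred I) (A : I -> 'M[F]_N)
    (D : 'M[F]_N) :
  (w <= \sum_(j | P j) A j)%MS -> (forall j, P j -> (twist i (A j) <= D)%MS) ->
  (twist i w <= D)%MS.
Proof.
case/sub_sumsmxP=> u -> AD; rewrite twist_sum summx_sub // => j Pj.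
by rewrite twistM mulmx_sub ?AD.
Qed.

(** Semilinearity makes the scalars accumulate as c sigma(c) sigma^2(c)...; only their being nonzero
    matters for subspaces. *)
Lemma iter_psiE (psi : 'rV[F]_N -> 'rV[F]_N) (c : F) : c != 0 ->
  (forall v, psi v = c *: twist 1 v) ->
  forall i, exists2 ci : F, ci != 0 & forall v, iter i psi v = ci *: twist i v.
Proof.
move=> c0 psiE; elim=> [|i [ci ci0 IH]].
  by exists 1; rewrite ?oner_neq0 // => v; rewrite twist0 scale1r.
exists (c * sigma ci); first by rewrite mulf_neq0 ?fmorph_eq0.
move=> v; rewrite /= IH psiE (twist_semilinear 1).2 -scalerA /=.
by rewrite -[i.+1]add1n twist_add.
Qed.

Lemma psi_img_eqmx (psi : 'rV[F]_N -> 'rV[F]_N) (c : F) : c != 0 ->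
  (forall v, psi v = c *: twist 1 v) ->
  forall i A, (psi_img psi i A :=: twist i A)%MS.
Proof.
move=> c0 psiE i A; have [ci ci0 e] := iter_psiE c0 psiE i.
suff -> : psi_img psi i A = ci *: twist i A by apply: eqmx_scale.
apply/matrixP=> k l; rewrite !mxE e !mxE; congr (_ * _); apply: eq_bigr => j _.
by rewrite !mxE; congr (rmorph_iter i _ * _); apply: eq_bigr => h _; rewrite !mxE.
Qed.

(** * The direct decomposition of V into cyclically permuted summands *)

Section SpanningTwists.
Variables (t n : nat) (Th : 'M[F]_N) (X : 'I_t -> 'M[F]_N).
Hypotheses (N_eq : N = (t * n)%N).
Hypothesis sigma_t : forall x, rmorph_iter t x = x.
Hypotheses (X_eq : forall i, (X i :=: twist i Th)%MS) (rTh : \rank Th = n).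
Hypothesis X_span : (1%:M <= \sum_i X i)%MS.

Lemma twist_period m (A : 'M[F]_(m, N)) : twist t A = A.
Proof. by rewrite /twist map_mx_id // mulmxKV. Qed.

Lemma twist_mod k m (A : 'M[F]_(m, N)) : twist (k %% t) A = twist k A.
Proof.
rewrite [in RHS](divn_eq k t) addnC twist_add; congr (twist _ _).
by elim: (k %/ t)%N => [|h IH]; rewrite ?mul0n ?twist0 // mulSn twist_add -IH twist_period.
Qed.

Lemma twist_eqmx i m p (A : 'M[F]_(m, N)) (C : 'M[F]_(p, N)) :
  (A :=: C)%MS -> (twist i A :=: twist i C)%MS.
Proof. by move=> eAC; apply/eqmxP; rewrite !twist_sub !eAC submx_refl. Qed.

Lemma twist_X d (i k : 'I_t) : i + d = k %[mod t] -> (twist d (X i) :=: X k)%MS.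
Proof.
move=> idk; apply: eqmx_trans (twist_eqmx d (X_eq i)) _.
rewrite -twist_add addnC -twist_mod idk twist_mod.
exact: eqmx_sym.
Qed.

Lemma rank_X i : \rank (X i) = n.
Proof. by rewrite X_eq rank_twist. Qed.

Let leq_rank_sum_X (P : pred 'I_t) : (\rank (\sum_(i | P i) X i)%MS <= #|P| * n)%N.
Proof.
apply: leq_trans (mxrank_sums_leq _ _) _.
by rewrite (eq_bigr (fun=> n)) ?sum_nat_const // => i _; rewrite rank_X.
Qed.

Let rank_sum_XC (P : pred 'I_t) :
  \rank ((\sum_(i | P i) X i) + (\sum_(i | ~~ P i) X i))%MS = (#|P| * n + #|predC P| * n)%N.
Proof.
rewrite -mulnDl cardC card_ord -N_eq -(bigID P xpredT) /=.
by apply/eqP; rewrite -[_ == N]/(row_full _) -sub1mx.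
Qed.

(** Two complementary partial sums have ranks at most |P| n and (t - |P|) n, yet together they span
    a space of dimension tn; both bounds are therefore attained. *)
Lemma rank_sum_X (P : pred 'I_t) : \rank (\sum_(i | P i) X i)%MS = (#|P| * n)%N.
Proof.
apply/eqP; rewrite eqn_leq leq_rank_sum_X -(leq_add2r (#|predC P| * n)) -rank_sum_XC.
by apply: leq_trans (mxrank_adds_leqif _ _).1 _; rewrite leq_add2l leq_rank_sum_X.
Qed.

Lemma cap_sum_X (P : pred 'I_t) :
  ((\sum_(i | P i) X i) :&: (\sum_(i | ~~ P i) X i))%MS = 0.
Proof.
apply/eqP; rewrite -mxrank_eq0.
have := mxrank_sum_cap (\sum_(i | P i) X i)%MS (\sum_(i | ~~ P i) X i)%MS.
rewrite rank_sum_XC !rank_sum_X => /eqP.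
by rewrite -[X in _ == X]addn0 eqn_add2l.
Qed.

Definition component (i : 'I_t) : 'M[F]_N := proj_mx (X i) (\sum_(j | j != i) X j)%MS.

Let cap_others i : (X i :&: \sum_(j | j != i) X j)%MS = 0.
Proof. by have := cap_sum_X (pred1 i); rewrite (big_pred1 i). Qed.

Lemma component_id i m (w : 'M[F]_(m, N)) : (w <= X i)%MS -> w *m component i = w.
Proof. exact: proj_mx_id. Qed.

Lemma component_others i m (w : 'M[F]_(m, N)) :
  (w <= \sum_(j | j != i) X j)%MS -> w *m component i = 0.
Proof. exact: proj_mx_0. Qed.

Lemma component_sub i m (w : 'M[F]_(m, N)) : (w *m component i <= X i)%MS.
Proof. exact: proj_mx_sub. Qed.

Lemma sum_components m (w : 'M[F]_(m, N)) : \sum_i w *m component i = w.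
Proof.
have /sub_sumsmxP[u ->] : (w <= \sum_i X i)%MS by exact: submx_trans (submx1 _) X_span.
apply: eq_bigr => i _; rewrite mulmx_suml (bigD1 i) //= component_id ?submxMl //.
rewrite big1 ?addr0 // => j ji; rewrite component_others //.
by apply: (sumsmx_sup j); rewrite ?submxMl.
Qed.

Lemma ord_bound_gt0 (i : 'I_t) : (0 < t)%N. Proof. exact: leq_ltn_trans (ltn_ord i). Qed.

(** Apply the d-th power of the action to w = w_i + r, with r in the other summands. It fixes w,
    carries X i to X k and carries the other summands to summands different from X k. *)
Lemma component_fixed m (w : 'M[F]_(m, N)) d (i k : 'I_t) : twist 1 w = w -> i + d = k %[mod t] ->
  w *m component k = twist d (w *m component i).
Proof.
move=> fw idk; pose r := \sum_(j | j != i) w *m component j.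
have wE : w = w *m component i + r by rewrite -[LHS]sum_components (bigD1 i).
rewrite -{1}(twist_fixed d fw) {1}wE twistD mulmxDl component_id; last first.
  by rewrite -(twist_X idk) twist_sub component_sub.
rewrite [twist d r *m _]component_others ?addr0 //.
apply: (@twist_sums_sub _ _ _ _ (fun j => j != i) X).
  by apply: summx_sub => j ji; apply: (sumsmx_sup j); rewrite ?component_sub.
move=> j /= ji; pose h := Ordinal (ltn_pmod (j + d) (ord_bound_gt0 i)).
apply: (sumsmx_sup h); last by rewrite (twist_X (k := h)) //= modn_mod.
apply: contra ji => /eqP hk; apply/eqP/val_inj.
rewrite /= -(modn_small (ltn_ord i)) -(modn_small (ltn_ord j)).
by apply/eqP; rewrite -(eqn_modDr d) idk -hk /= modn_mod.
Qed.

Lemma fixed_eq0 (w : 'rV[F]_N) i : twist 1 w = w -> w *m component i = 0 -> w = 0.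
Proof.
move=> fw wi0; rewrite -(sum_components w) big1 // => k _.
(* k + (t - i) represents k - i modulo t without truncated subtraction. *)
rewrite (@component_fixed _ w (k + (t - i)) i k) // ?wi0 ?twist_mx0 //.
by rewrite addnCA subnKC ?modnDr // ltnW.
Qed.

(** The trace-like sum of all twists of u is fixed, and only its term k = 0 lies in X i. *)
Lemma component_surj (u : 'rV[F]_N) i : (u <= X i)%MS ->
  exists2 w, twist 1 w = w & w *m component i = u.
Proof.
move=> ui; exists (\sum_(k < t) twist k u).
  (* With the term k = 0 added, both sides become the sum over k <= t, since the t-th twist of u is
     u. *)
  rewrite twist_sum; apply: (addrI (twist 0 u)).
  under eq_bigr => k _ do rewrite -twist_add.
  transitivity (\sum_(k < t.+1) twist k u); first by rewrite big_ord_recl.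
  by rewrite big_ord_recr /= twist_period twist0 addrC.
rewrite mulmx_suml (bigD1 (Ordinal (ord_bound_gt0 i))) //= twist0 component_id //.
rewrite big1 ?addr0 // => k k0.
pose h := Ordinal (ltn_pmod (i + k) (ord_bound_gt0 i)).
rewrite component_others //; apply: (sumsmx_sup h); last first.
  by rewrite -(@twist_X k i h) ?twist_sub //= modn_mod.
apply: contra k0 => /eqP/(congr1 val) /= ik; apply/eqP/val_inj => /=.
rewrite -(modn_small (ltn_ord k)); apply/eqP.
by rewrite -(mod0n t) -(eqn_modDl i) addn0 ik modn_small.
Qed.

Section TwoSummands.
Variables i1 i2 : 'I_t.
Hypothesis neq_i : i1 != i2.

Let Gamma := (\sum_(i < t | (i != i1) && (i != i2)) X i)%MS.

(** Stated for any commutative law, to cover both sums of subspaces and sums of vectors. *)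
Let sum_pair (R : Type) (idx : R) (op : Monoid.com_law idx) (f : 'I_t -> R) :
  \big[op/idx]_(i | ~~ ((i != i1) && (i != i2))) f i = op (f i1) (f i2).
Proof.
rewrite (bigD1 i1) ?eqxx //= (big_pred1 i2) // => i /=.
rewrite negb_and !negbK; have [->|_] := eqVneq i i1; last by rewrite andbT.
by rewrite (negPf neq_i).
Qed.

Lemma rank_sum_X_but2 : \rank Gamma = (n * (t - 2))%N.
Proof.
rewrite rank_sum_X mulnC; congr (_ * _)%N.
have := cardC (pred2 i1 i2); rewrite card2 neq_i card_ord => e.
by rewrite -[X in (X - 2)%N]e addKn; apply: eq_card => i; rewrite !inE negb_or.
Qed.

Lemma cap_sum_X_but2 : (Gamma :&: (X i1 + X i2))%MS = 0.
Proof. by rewrite -(sum_pair _ X) cap_sum_X. Qed.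

Lemma rank_X_pair : \rank (X i1 + X i2)%MS = (2 * n)%N.
Proof.
rewrite -(sum_pair _ X) rank_sum_X; congr (_ * _)%N.
transitivity #|pred2 i1 i2|; last by rewrite card2 neq_i.
by apply: eq_card => i; rewrite [LHS]unfold_in !inE negb_and !negbK.
Qed.

Lemma cap_X_pair : (X i1 :&: X i2)%MS = 0.
Proof.
apply/eqP; rewrite -submx0 -(cap_others i1); apply: capmxS => //.
by apply: (sumsmx_sup i2); rewrite // eq_sym.
Qed.

(** A vector of Gamma has zero component in X i1, and for a fixed vector one zero component makes
    all vanish. Hence Gamma misses Sigma. *)
Lemma sum_X_but2_fixed (w : 'rV[F]_N) : twist 1 w = w -> (w <= Gamma)%MS -> w = 0.
Proof.
move=> fw wG; apply: (fixed_eq0 (i := i1) fw); apply: component_others.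
apply: submx_trans wG _; apply/sumsmx_subP=> i /andP[ii1 _].
by apply: (sumsmx_sup i).
Qed.

(** Write w = r + y with r in Gamma and y in L = X i1 + X i2. By the modular law (Gamma + y) meets L
    in y + (Gamma meet L), which is just y. *)
Lemma projection_components (w : 'rV[F]_N) :
  ((Gamma + w) :&: (X i1 + X i2) :=: (w *m component i1 + w *m component i2)%R)%MS.
Proof.
set y := (w *m component i1 + _)%R; set L := (X i1 + X i2)%MS.
have yL : (y <= L)%MS by rewrite addmx_sub_adds ?component_sub.
have [r rG wE] : exists2 r : 'rV_N, (r <= Gamma)%MS & w = r + y.
  exists (\sum_(i | (i != i1) && (i != i2)) w *m component i).
    by apply: summx_sub => i Pi; apply: (sumsmx_sup i); rewrite ?component_sub.
  by rewrite -[LHS]sum_components (bigID (fun i => (i != i1) && (i != i2))) /= sum_pair.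
have Gwy : (Gamma + w :=: y + Gamma)%MS.
  have yE : y = - r + w by rewrite [in RHS]wE addKr.
  apply/eqmxP/andP; split; rewrite addsmx_sub.
    by rewrite addsmxSr wE addmx_sub ?addsmxSl // (submx_trans rG) ?addsmxSr.
  by rewrite addsmxSl andbT yE addmx_sub ?eqmx_opp ?addsmxSr // (submx_trans rG) ?addsmxSl.
apply: eqmx_trans (cap_eqmx Gwy (eqmx_refl _)) _.
apply: eqmx_trans (eqmx_sym (matrix_modl _ yL)) _.
by rewrite cap_sum_X_but2; apply: addsmx0.
Qed.

End TwoSummands.
End SpanningTwists.
End TwistedAction.

(** * Psi in the frame of the fixed subgeometry *)

Section Frame.
Variables (F : finFieldType) (q N : nat) (sigma : {rmorphism F -> F}).
Variable psi : 'rV[F]_N -> 'rV[F]_N.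
Hypotheses (psi_semi : semilinear_map sigma psi) (psi_inj : injective psi).

Let psi_sum (I : Type) (r : seq I) (P : pred I) (v : I -> 'rV[F]_N) :
  psi (\sum_(i <- r | P i) v i) = \sum_(i <- r | P i) psi (v i).
Proof.
have psi0 : psi 0 = 0 by have := psi_semi.2 0 0; rewrite rmorph0 !scale0r.
by apply: (big_morph psi psi_semi.1 psi0).
Qed.

Let psi_eq0 v : (psi v == 0) = (v == 0).
Proof.
have psi0 : psi 0 = 0 by have := psi_semi.2 0 0; rewrite rmorph0 !scale0r.
by rewrite -{1}psi0 (inj_eq psi_inj).
Qed.

Lemma fixed_subgeometry_frame : (0 < q)%N -> (1 < N)%N -> fixed_subgeometry q psi ->
  exists2 B : 'M[F]_N, B \in unitmx &
  [/\ exists2 c, c != 0 & forall v, psi v = c *: twist sigma B 1 v,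
      forall x, sigma x = x <-> in_Fq q x &
      forall v, fixed_pt psi v ->
        exists2 w : 'rV[F]_N, twist sigma B 1 w = w & (v :=: w)%MS].
Proof.
move=> q_gt0 N_gt1 [B uB fixB]; exists B => //.
have Fq0 : in_Fq q (0 : F) by rewrite /in_Fq expr0n eqn0Ngt q_gt0.
have Fq1 : in_Fq q (1 : F) by rewrite /in_Fq expr1n.
have mulB0 (u : 'rV_N) : u != 0 -> u *m B != 0.
  by apply: contraNneq => uB0; rewrite -(mulmxK uB u) uB0 mul0mx.
have fixedB (u : 'rV_N) : u != 0 -> (forall j, in_Fq q (u 0 j)) ->
    exists c, psi (u *m B) = c *: (u *m B).
  move=> u0 uq; apply/sub_rVP.
  suff /andP[] : fixed_pt psi (u *m B) by [].
  by apply/fixB; [exact: mulB0 | exists u; rewrite submx_refl].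
pose j0 : 'I_N := Ordinal (ltnW N_gt1); pose j1 : 'I_N := Ordinal N_gt1.
have d0 (j : 'I_N) : delta_mx 0 j != 0 :> 'rV[F]_N.
  by apply/eqP=> /rowP/(_ j)/eqP; rewrite !mxE !eqxx oner_eq0.
have dq (j k : 'I_N) : in_Fq q ((delta_mx 0 j : 'rV[F]_N) 0 k).
  by rewrite mxE eqxx; case: (k == j).
(* The unit point of the frame: since Psi fixes it as well as the basis points, the scalars at all
   basis vectors agree with its scalar c. *)
pose e : 'rV[F]_N := const_mx 1.
have e0 : e != 0 by apply/eqP=> /rowP/(_ j0)/eqP; rewrite !mxE oner_eq0.
have [c ec] : exists c, psi (e *m B) = c *: (e *m B) by apply: fixedB => // j; rewrite mxE.
have c0 : c != 0.
  apply: contra_neq (mulB0 e e0) => c0; apply/eqP.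
  by rewrite -psi_eq0 ec c0 scale0r.
have dc (j : 'I_N) : psi (delta_mx 0 j *m B) = c *: (delta_mx 0 j *m B).
  have /fin_all_exists[cj cjE] : forall j : 'I_N, exists cj,
      psi (delta_mx 0 j *m B) = cj *: (delta_mx 0 j *m B).
    by move=> k; apply: fixedB => // l; exact: dq.
  rewrite cjE; congr (_ *: _).
  have : psi (e *m B) = (\sum_k cj k *: delta_mx 0 k) *m B.
    rewrite (row_sum_delta e) !mulmx_suml psi_sum; apply: eq_bigr => k _.
    by rewrite mxE scale1r cjE -scalemxAl.
  rewrite ec scalemxAl => /(can_inj (mulmxK uB))/rowP/(_ j).
  rewrite !mxE mulr1 summxE (bigD1 j) //= big1 => [|k kj].
    by rewrite !mxE !eqxx mulr1 addr0.
  by rewrite !mxE eqxx [j == k]eq_sym (negPf kj) mulr0.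
have psiE v : psi v = c *: twist sigma B 1 v.
  rewrite -{1}(mulmxKV uB v) (row_sum_delta (v *m invmx B)) mulmx_suml psi_sum.
  rewrite /twist [map_mx _ _]row_sum_delta mulmx_suml scaler_sumr; apply: eq_bigr => j _.
  by rewrite -!scalemxAl psi_semi.2 dc !scalerA mulrC [map_mx _ _ _ _]mxE.
have twistB (u : 'rV_N) : twist sigma B 1 (u *m B) = map_mx sigma u *m B.
  by rewrite /twist mulmxK.
have sigma_fix a : sigma a = a <-> in_Fq q a.
  (* The point (1, a, 0, ..., 0) tests a: it is fixed exactly when sigma(a) = a, and it has
     F_q-coordinates up to a scalar k exactly when a is in F_q. The coordinate 1 forces k into
     F_q. *)
  pose u : 'rV[F]_N := delta_mx 0 j0 + a *: delta_mx 0 j1.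
  have uj0 : u 0 j0 = 1 by rewrite !mxE eqxx /= mulr0 addr0.
  have uj1 : u 0 j1 = a by rewrite !mxE eqxx /= mulr1 add0r.
  have u0 : u != 0 by apply/eqP=> /rowP/(_ j0)/eqP; rewrite uj0 mxE oner_eq0.
  have uBE := fixB _ (mulB0 u u0); split=> [sa|aq].
    have /uBE[w [w0 wq /andP[wu _]]] : fixed_pt psi (u *m B).
      rewrite /fixed_pt mulB0 // psiE twistB scalemx_sub //.
      suff -> : map_mx sigma u = u by [].
      by rewrite map_mxD map_mxZ !map_delta_mx /= sa.
    move: wu; rewrite submxMfree ?row_free_unit // => uw.
    have /sub_rVP[k wE] : (w <= u)%MS by rewrite (eqmx_rV u0 uw).
    have kq : in_Fq q k by have := wq j0; rewrite wE mxE uj0 mulr1.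
    have kaq : in_Fq q (k * a) by have := wq j1; rewrite wE mxE uj1.
    have k0 : k != 0 by apply: contraNneq w0 => k0; rewrite wE k0 scale0r.
    move: kaq; rewrite /in_Fq exprMn (eqP kq) => /eqP/(mulfI k0) ->.
    exact: eqxx.
  have [k] : exists k, psi (u *m B) = k *: (u *m B).
    apply: fixedB => // j; rewrite !mxE eqxx /=.
    have [->|_] := eqVneq j j0; first by rewrite mulr0 addr0.
    by rewrite add0r; case: (j == j1); rewrite ?mulr1 ?mulr0.
  rewrite psiE twistB !scalemxAl => /(can_inj (mulmxK uB))/rowP uE.
  have := uE j0; rewrite mxE [map_mx _ _ _ _]mxE [RHS]mxE uj0 rmorph1 !mulr1 => ck.
  by have := uE j1; rewrite mxE [map_mx _ _ _ _]mxE [RHS]mxE uj1 -ck => /(mulfI c0).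
split; [by exists c | exact: sigma_fix |] => v vfix.
have /andP[v0 _] := vfix; have [u [u0 uq vu]] := (fixB v v0).1 vfix.
exists (u *m B); last exact/eqmxP.
by rewrite twistB; congr (_ *m _); apply/rowP=> j; rewrite mxE; apply/sigma_fix.
Qed.

(** Order t says only that psi^t is a scalar k. Comparing with ct sigma^t on multiples b of a frame
    vector gives ct sigma^t(b) = k b; b = 1 yields ct = k. *)
Lemma rmorph_iter_collineation_order (t : nat) (B : 'M[F]_N) (c : F) : (0 < N)%N ->
  B \in unitmx -> c != 0 -> (forall v, psi v = c *: twist sigma B 1 v) ->
  collineation_order psi t -> forall x, rmorph_iter sigma t x = x.
Proof.
move=> N_gt0 uB c0 psiE [_ [[k kE] _]] a.
have [ct ct0 ctE] := iter_psiE uB c0 psiE t.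
pose j0 : 'I_N := Ordinal N_gt0.
have key b : ct * rmorph_iter sigma t b = k * b.
  have := ctE ((b *: delta_mx 0 j0) *m B); rewrite kE /twist mulmxK // !scalemxAl.
  move/(can_inj (mulmxK uB))/rowP/(_ j0); rewrite !mxE !eqxx /= !mulr1.
  by move->.
have kct : ct = k by have := key 1; rewrite rmorph1 !mulr1.
by apply: (mulfI ct0); rewrite key kct.
Qed.

End Frame.

(** * Exponents modulo t *)

Lemma rmorph_iter_coprime_fix (F : finFieldType) (sigma : {rmorphism F -> F}) (d t : nat) (x : F) :
  (0 < d)%N -> coprime d t -> (forall y, rmorph_iter sigma t y = y) ->
  rmorph_iter sigma d x = x -> sigma x = x.
Proof.
(* Bezout: km d = kn t + 1, so applying sigma km d times to x gives both x and sigma(x). *)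
move=> d0 /eqP cop st dx; have [km kn e _] := egcdnP t d0.
have iter_fix k m y : iter m sigma y = y -> iter (k * m) sigma y = y.
  by move=> my; elim: k => // k IH; rewrite mulSn iterD IH.
have := iter_fix km d x; rewrite -rmorph_iterE => /(_ dx).
rewrite e cop addn1 /= iter_fix // -rmorph_iterE.
exact: st.
Qed.

Lemma coprime_subl (a t : nat) : (a <= t)%N -> coprime (t - a) t = coprime a t.
Proof. by move=> /subnK {2 3}<-; rewrite /coprime gcdnDl gcdnDr gcdnC. Qed.

(** [maxn - minn] is |i2 - i1|. If i2 < i1, the positive gap goes round the cycle, as t - (i1 - i2),
    which keeps its gcd with t. Equal indices would force t = 1. *)
Lemma coprime_cyclic_gap (t : nat) (i1 i2 : 'I_t) : (1 < t)%N ->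
  coprime (maxn i1 i2 - minn i1 i2) t ->
  exists d, [/\ (0 < d)%N, i1 + d = i2 %[mod t] & coprime d t].
Proof.
move=> t1; have i1t := ltnW (ltn_ord i1).
case: (ltngtP i1 i2) => [lt12 cop|lt21 cop|_]; last first.
- by rewrite subnn /coprime gcd0n => /eqP t_eq1; rewrite t_eq1 in t1.
- have le_t : (i1 - i2 <= t)%N by rewrite leq_subLR (leq_trans i1t) ?leq_addl.
  exists (t - (i1 - i2))%N; split; last by rewrite coprime_subl.
  + rewrite subn_gt0; apply: leq_ltn_trans (ltn_ord i1); exact: leq_subr.
  + by rewrite -{1}(subnKC (ltnW lt21)) -addnA subnKC // modnDr.
- exists (i2 - i1)%N; rewrite subn_gt0 lt12 subnKC //; exact: ltnW.
Qed.

(** * The projection of Sigma from Gamma as a graph *)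

Theorem theorem3p9 (F : finFieldType) (q t n : nat)
  (psi : 'rV[F]_(t * n) -> 'rV[F]_(t * n)) (sigma : {rmorphism F -> F})
  (Theta : 'M[F]_(t * n)) (i1 i2 : 'I_t) :
  (2 <= n)%N -> (3 <= t)%N -> #|F| = (q ^ t)%N ->
  semilinear_map sigma psi -> bijective psi -> collineation_order psi t ->
  fixed_subgeometry q psi ->
  director_space t n psi Theta ->
  coprime (maxn i1 i2 - minn i1 i2) t ->
  let Gamma := (\sum_(i < t | (i != i1) && (i != i2)) psi_img psi i Theta)%MS in
  let Lambda := (psi_img psi i1 Theta + psi_img psi i2 Theta)%MS in
  [/\ \rank Gamma = (n * (t - 2))%N,
      (forall v, fixed_pt psi v -> ~~ (v <= Gamma)%MS),
      (Gamma :&: Lambda == (0 : 'M[F]_(t * n)))%MS,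
      \rank Lambda = (2 * n)%N &
      exists U : {set 'rV[F]_(t * n)},
        [/\ [/\ Fq_subspace q U, (forall u, u \in U -> (u <= Lambda)%MS) & #|U| = (q ^ (t * n))%N],
            scattered q U,
            projection psi Gamma Lambda = linear_set U,
            type_L_rho_f q n Lambda (linear_set U) &
            pseudoregulus q t n Lambda U (psi_img psi i1 Theta) (psi_img psi i2 Theta)]].
Proof.
move=> n_gt1 t_gt2 cF psi_semi psi_bij psi_ord psi_fix director cop Gamma Lambda.
have t_gt1 := ltnW t_gt2; have t_gt0 := ltnW t_gt1.
have q_gt0 : (0 < q)%N.
  by have := ltnW (finRing_gt1 F); rewrite cF expn_gt0 eqn0Ngt t_gt0 orbF.
have N_gt1 : (1 < t * n)%N by apply: leq_trans n_gt1 _; rewrite leq_pmull.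
have psi_inj := bij_inj psi_bij.
have [B uB [[c c0 psiE] sigma_fix fixed_rep]] :=
  fixed_subgeometry_frame psi_semi psi_inj q_gt0 N_gt1 psi_fix.
have sigma_t := rmorph_iter_collineation_order (ltnW N_gt1) uB c0 psiE psi_ord.
have imgE := psi_img_eqmx uB c0 psiE.
pose X (i : 'I_t) := psi_img psi i Theta.
have X_eq i : (X i :=: twist sigma B i Theta)%MS by exact: imgE.
have [Th0 [j [rTh0 span /eqmxP ThE]]] := director.
have ThE0 : (Theta :=: twist sigma B j Th0)%MS by exact: eqmx_trans ThE (imgE _ _).
have rTh : \rank Theta = n by rewrite ThE0 rank_twist.
have X_span : (1%:M <= \sum_i X i)%MS.
  have /andP[_ span1] := span; apply: submx_trans span1 _.
  (* Theta is the j-th image of Th0, so its image of index h = k - j modulo t is the k-th image of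
     Th0; hence the images of Theta also span. *)
  apply/sumsmx_subP => k _; pose h := Ordinal (ltn_pmod (k + (t - j)) t_gt0).
  apply: (sumsmx_sup h) => //; rewrite X_eq imgE (twist_eqmx _ uB _ ThE0) -twist_add //.
  rewrite -(twist_mod uB sigma_t (h + j)) /= modnDml -addnA subnK; last exact: ltnW.
  by rewrite modnDr (twist_mod uB sigma_t).
have [d [d_gt0 gap cop_d]] := coprime_cyclic_gap t_gt1 cop.
have neq_i : i1 != i2.
  apply: contraTneq cop => <-; rewrite maxnn minnn subnn /coprime gcd0n.
  by rewrite neq_ltn t_gt1 orbT.
pose g := @twist F _ sigma B d 1; pose tau := rmorph_iter sigma d.
have tau_fix x : tau x = x <-> in_Fq q x.
  split=> [tx|/sigma_fix sx].
    exact/sigma_fix/(rmorph_iter_coprime_fix d_gt0 cop_d sigma_t tx).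
  by rewrite /tau rmorph_iterE; elim: (d) => //= k ->.
have g_semi : semilinear_map tau g by exact: twist_semilinear.
have g_inj : injective g by exact: twist_inj.
have gE u : (g u <= X i2)%MS = (u <= X i1)%MS.
  by rewrite -(twist_X uB sigma_t X_eq gap) twist_sub.
have capX : (X i1 :&: X i2)%MS = 0 by exact: (cap_X_pair uB erefl X_eq rTh X_span).
have rX i : \rank (X i) = n by exact: (rank_X uB X_eq rTh).
have eqmx_neq0 (v w : 'rV[F]_(t * n)) : (v :=: w)%MS -> v != 0 -> w != 0.
  by move=> vw; rewrite -!mxrank_eq0 vw.
split.
- exact: (rank_sum_X_but2 uB erefl X_eq rTh X_span neq_i).
- move=> v vfix; have [w fw vw] := fixed_rep v vfix; have /andP[v0 _] := vfix.
  apply: contra (eqmx_neq0 _ _ vw v0); rewrite vw.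
  by move/(sum_X_but2_fixed uB erefl sigma_t X_eq rTh X_span fw) => ->.
- by rewrite (cap_sum_X_but2 uB erefl X_eq rTh X_span neq_i) submx_refl.
- exact: (rank_X_pair uB erefl X_eq rTh X_span neq_i).
exists (graph_set (X i1) g); split.
- split; first exact: graph_set_Fq_subspace tau_fix g_semi.
  + exact: graph_set_sub.
  + exact: card_graph_set cF capX (rX i1) gE.
- exact: graph_set_scattered cF tau_fix capX g_semi g_inj gE.
- have fixed_components (w : 'rV[F]_(t * n)) : twist sigma B 1 w = w ->
      w *m component X i1 + w *m component X i2 = w *m component X i1 + g (w *m component X i1).
    by move=> fw; rewrite (component_fixed uB erefl sigma_t X_eq rTh X_span fw gap).
  have projE (v w : 'rV[F]_(t * n)) : twist sigma B 1 w = w -> (v :=: w)%MS ->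
      <<((Gamma + v) :&: Lambda)>>%MS = <<w *m component X i1 + g (w *m component X i1)>>%MS.
    move=> fw vw; apply: eq_genmx; rewrite -fixed_components //.
    apply: eqmx_trans (cap_eqmx (adds_eqmx (eqmx_refl _) vw) (eqmx_refl _)) _.
    exact: (projection_components uB erefl X_eq rTh X_span neq_i).
  have graph_sum_eq0 u : (u <= X i1)%MS -> u + g u = 0 -> u = 0.
    move=> u1 /eqP; rewrite addr_eq0 => /eqP ugu; apply: (sub_capmx0 capX) => //.
    by rewrite ugu eqmx_opp gE.
  apply/setP=> P; apply/imsetP/imsetP => [[v]|[y]].
    rewrite inE => vfix ->; have [w fw vw] := fixed_rep v vfix; have /andP[v0 _] := vfix.
    have w0 := eqmx_neq0 _ _ vw v0.
    exists (w *m component X i1 + g (w *m component X i1)); last exact: projE.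
    rewrite !inE; apply/andP; split.
      apply: contra w0 => /eqP e; apply/eqP.
      apply: (fixed_eq0 uB erefl sigma_t X_eq rTh X_span (i := i1) fw).
      exact: graph_sum_eq0 (component_sub _ _ _) e.
    by apply/imsetP; exists (w *m component X i1); rewrite // inE component_sub.
  (* For the reverse inclusion, any u in X i1 is the i1-component of a vector w fixed by the action;
     the point <w> of Sigma projects to u + g u. *)
  case/setD1P=> y0 /imsetP[u]; rewrite inE => u1 yE ->.
  have [w fw wu] := component_surj uB erefl sigma_t X_eq rTh X_span u1.
  exists w; last by rewrite yE (projE w w) // wu.
  rewrite inE /fixed_pt psiE fw scalemx_sub // andbT.
  apply: contraNneq y0 => w0; rewrite yE -wu w0 mul0mx add0r /g twist_mx0.
  exact: eqxx.
- exact: graph_set_type_L_rho_f tau_fix capX (rX i1) (rX i2) g_semi g_inj gE.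
- exact: graph_set_pseudoregulus cF t_gt1 n_gt1 tau_fix capX (rX i1) (rX i2) g_semi g_inj gE.
Qed.
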